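(* Let $F=\{f_1=b_1,\dots,f_m=b_m\}$ be an unsatisfiable width-$d$ system of linear equations over $\mathbb{F}_q$. There is a Stabbing Planes refutation of (the CNF encoding of) $F$ of size $(mqd)^{O(\log m)}q^d=|F|^{O(\log m)}$.
   Context: Width $d$ means each equation $f_i=a_iz$ (with $a_i\in\mathbb{F}_q^n$, $b_i\in\mathbb{F}_q$) has at most $d$ variables with nonzero coefficient. In the CNF encoding each $\mathbb{F}_q$-valued variable is encoded by Boolean variables and each equation by $q^{d-1}$ width-$d$ clauses, one ruling out each falsifying assignment; $|F|:=mq^{d-1}$. The CNF is translated into linear inequalities in the standard way. Stabbing Planes: a refutation is a binary tree; each internal node is labelled by a query $(ax\le b-1,ax\ge b)$ with integer $a,b$ whose outgoing edges carry these two inequalities; each leaf is labelled by a nonnegative linear combination of the input inequalities and those on its root path yielding $0\ge1$; size = number of queries. *)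

(* Defs.v *)
From HB Require Import structures.
From mathcomp Require Import all_boot all_order all_algebra.

Set Implicit Arguments.
Unset Strict Implicit.
Unset Printing Implicit Defensive.

Import Order.TTheory GRing.Theory Num.Theory.

Local Open Scope ring_scope.

(* [(v, true)] is the literal v and [(v, false)] is its negation. *)
Definition literal (V : finType) : finType := (V * bool)%type.
Definition clause (V : finType) : finType := {set literal V}.
Definition cnf (V : finType) : finType := {set clause V}.

(* [(a, b)] stands for the inequality \sum_v a_v x_v >= b. *)
Definition lineq (V : finType) : eqType := ({ffun V -> int} * int)%type.

Section Inequalities.
Variable V : finType.

(* \sum_(v in C) x_v + \sum_(~ v in C) (1 - x_v) >= 1, with the constants moved
   to the right-hand side. *)
Definition clause_lineq (C : clause V) : lineq V :=
  ([ffun v => ((v, true) \in C)%:Z - ((v, false) \in C)%:Z],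
   1 - #|[set v | (v, false) \in C]|%:Z).

Definition lower_lineq (u : V) : lineq V := ([ffun v => (v == u)%:Z], 0).
Definition upper_lineq (u : V) : lineq V := ([ffun v => - (v == u)%:Z], - 1).

Definition cnf_lineqs (Phi : cnf V) : seq (lineq V) :=
  [seq clause_lineq C | C <- enum Phi]
    ++ [seq lower_lineq u | u <- enum V] ++ [seq upper_lineq u | u <- enum V].

(* a x >= b and a x <= b - 1, the latter as - a x >= 1 - b. *)
Definition query_ge (a : {ffun V -> int}) (b : int) : lineq V := (a, b).
Definition query_le (a : {ffun V -> int}) (b : int) : lineq V :=
  ([ffun v => - a v], 1 - b).

(* [w] is a nonnegative rational combination of members of [H] whose sum is
   the inequality 0 >= 1. *)
Definition conic_contradiction (H : seq (lineq V)) (w : seq (rat * lineq V)) :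
    bool :=
  [&& all (fun p => (0 <= p.1) && (p.2 \in H)) w,
      [forall v, \sum_(p <- w) p.1 * (p.2.1 v)%:~R == 0]
    & \sum_(p <- w) p.1 * p.2.2%:~R == 1].

(* In [SPNode a b l r], [l] hangs below the edge a x <= b - 1 and [r] below the
   edge a x >= b. *)
Inductive sp_tree : Type :=
  | SPLeaf of seq (rat * lineq V)
  | SPNode of {ffun V -> int} & int & sp_tree & sp_tree.

(* [H] holds the input inequalities together with those on the path from the
   root. *)
Fixpoint sp_valid (H : seq (lineq V)) (t : sp_tree) : bool :=
  match t with
  | SPLeaf w => conic_contradiction H w
  | SPNode a b l r =>
      sp_valid (query_le a b :: H) l && sp_valid (query_ge a b :: H) r
  end.

Fixpoint sp_size (t : sp_tree) : nat :=
  match t with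
  | SPLeaf _ => 0
  | SPNode _ _ l r => (sp_size l + sp_size r).+1
  end.

Definition sp_refutation (Phi : cnf V) (t : sp_tree) : bool :=
  sp_valid (cnf_lineqs Phi) t.

End Inequalities.

Section LinearSystems.
Variables (F : finFieldType) (m n : nat).

Definition eq_support (A : 'M[F]_(m, n)) (i : 'I_m) : {set 'I_n} :=
  [set j | A i j != 0].

Definition width_le (A : 'M[F]_(m, n)) (d : nat) : Prop :=
  forall i : 'I_m, (#|eq_support A i| <= d)%N.

Definition satisfiable (A : 'M[F]_(m, n)) (b : 'cV[F]_m) : Prop :=
  exists z : 'cV[F]_n, A *m z = b.

(* Direct encoding: the Boolean variable (j, c) means z_j = c. *)
Definition bvar : finType := ('I_n * F)%type.

Definition at_least_one (j : 'I_n) : clause bvar :=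
  [set ((j, c), true) | c in F].

Definition at_most_one (j : 'I_n) (c c' : F) : clause bvar :=
  [set ((j, c), false); ((j, c'), false)].

(* The clause excluding the restriction of [z] to the variables of equation i;
   assignments with the same restriction give the same clause. *)
Definition excl_clause (A : 'M[F]_(m, n)) (i : 'I_m) (z : 'cV[F]_n) :
    clause bvar :=
  [set ((j, z j 0), false) | j in eq_support A i].

Definition cnf_encoding (A : 'M[F]_(m, n)) (b : 'cV[F]_m) : cnf bvar :=
  [set at_least_one j | j : 'I_n]
    :|: [set at_most_one p.1 p.2.1 p.2.2
          | p : 'I_n * (F * F) & p.2.1 != p.2.2]
    :|: [set excl_clause A p.1 p.2
          | p : 'I_m * 'cV[F]_n & (A *m p.2) p.1 0 != b p.1 0].

End LinearSystems.

(* Main.v *)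
(* Fix y with y A = 0 and y b <> 0, and an additive map lam from F to Z/p, read as
   residues in [0, p), with lam (y b) <> 0. A set I of equations yields the linear
   form L_I = \sum_(j, c) lam ((\sum_(i in I) y_i A_ij) c) x_(j, c) in the Boolean
   variables, and the equations in I imply that L_I is congruent to
   lam (\sum_(i in I) y_i b_i) modulo p. The refutation keeps a set I on which the
   value of L_I is known and contradicts this congruence; at the start I contains
   all equations and L_I = 0. It halves I into I1 and I2 and queries the values of
   L_I1 and L_I2. Since L_I1 + L_I2 - L_I is p times an integer form, one more query
   refutes values that do not add up modulo p; otherwise the congruence fails on I1
   or on I2. After about log m halvings a single equation is left, and all values of
   its at most d variables are tried. *)

Require Import Defs.
From HB Require Import structures.
From mathcomp Require Import all_boot all_order all_algebra.
From mathcomp Require Import finfield vector zify lra.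

Set Implicit Arguments.
Unset Strict Implicit.
Unset Printing Implicit Defensive.

(** * Nonnegative combinations of inequalities *)

Section Derivations.
Import Order.TTheory GRing.Theory Num.Theory.
Local Open Scope ring_scope.
Variable V : finType.
Implicit Types (H : seq (lineq V)) (a : V -> rat) (b : rat).

Definition derives H a b : Prop :=
  exists w : seq (rat * lineq V),
    [/\ all (fun p => (0 <= p.1) && (p.2 \in H)) w,
        forall v, \sum_(p <- w) p.1 * (p.2.1 v)%:~R = a v
      & \sum_(p <- w) p.1 * p.2.2%:~R = b].

Lemma derives_mem H (l : lineq V) :
  l \in H -> derives H (fun v => (l.1 v)%:~R) l.2%:~R.
Proof.
by move=> Hl; exists [:: (1, l)]; split=> [|v|];
  rewrite /= ?big_seq1 ?mul1r ?Hl.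
Qed.

Lemma derives0 H : derives H (fun=> 0) 0.
Proof. by exists [::]; split=> [|v|]; rewrite ?big_nil. Qed.

Lemma derives_ext H a a' b b' :
  derives H a b -> a =1 a' -> b = b' -> derives H a' b'.
Proof.
by case=> w [w1 w2 <-] aa' <-; exists w; split=> // v; rewrite w2 aa'.
Qed.

Lemma derivesD H a b a' b' :
  derives H a b -> derives H a' b' ->
  derives H (fun v => a v + a' v) (b + b').
Proof.
case=> w [w1 w2 <-] [w' [w1' w2' <-]]; exists (w ++ w').
by split=> [|v|]; rewrite ?all_cat ?w1 // big_cat //= w2 w2'.
Qed.

Lemma derivesZ H c a b :
  0 <= c -> derives H a b -> derives H (fun v => c * a v) (c * b).
Proof.
move=> c0 [w [w1 w2 <-]]; exists [seq (c * p.1, p.2) | p <- w].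
split=> [|v|].
- rewrite all_map; apply: sub_all w1 => p /= /andP[p0 ->].
  by rewrite mulr_ge0.
- by rewrite big_map -w2 mulr_sumr; apply: eq_bigr => p _; rewrite mulrA.
- by rewrite big_map mulr_sumr; apply: eq_bigr => p _; rewrite mulrA.
Qed.

Lemma derives_sum H (I : Type) (r : seq I) (P : pred I)
    (a : I -> V -> rat) (b : I -> rat) :
  (forall i, P i -> derives H (a i) (b i)) ->
  derives H (fun v => \sum_(i <- r | P i) a i v) (\sum_(i <- r | P i) b i).
Proof.
move=> Hab; elim: r => [|i r IH].
  by apply: derives_ext (derives0 H) _ _ => [v|]; rewrite big_nil.
case Pi: (P i); last first.
  by apply: derives_ext IH _ _ => [v|]; rewrite big_cons Pi.
by apply: derives_ext (derivesD (Hab i Pi) IH) _ _ => [v|]; rewrite big_cons Pi.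
Qed.

Lemma derives_sub H H' a b : {subset H <= H'} -> derives H a b -> derives H' a b.
Proof.
move=> sHH' [w [w1 w2 w3]]; exists w; split=> //.
by apply: sub_all w1 => p /andP[-> /sHH'].
Qed.

Lemma derives_cons H l a b : derives H a b -> derives (l :: H) a b.
Proof. by apply: derives_sub => x Hx; rewrite inE Hx orbT. Qed.

Definition unit_vec (u v : V) : rat := (v == u)%:R.

Lemma sum_unit_vec (f : V -> rat) v : \sum_u f u * unit_vec u v = f v.
Proof.
rewrite (bigD1 v) //= /unit_vec eqxx mulr1 big1 ?addr0 // => u uv.
by rewrite eq_sym (negPf uv) mulr0.
Qed.

(** Bounds are asked only where [f] is nonzero, so that fixing the variables of one equation is
    enough to evaluate its form. *)
Lemma derives_lincomb H (f r : V -> rat) :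
  (forall v, 0 <= f v) ->
  (forall v, f v != 0 -> derives H (unit_vec v) (r v)) ->
  derives H f (\sum_v f v * r v).
Proof.
move=> f0 Hr.
have D v : derives H (fun u => f v * unit_vec v u) (f v * r v).
  have [fv|fv] := eqVneq (f v) 0; last exact: derivesZ (Hr v fv).
  by apply: derives_ext (derives0 H) _ _ => [u|]; rewrite fv mul0r.
apply: derives_ext (derives_sum (index_enum V) (fun v (_ : true) => D v)) _ _ => // v.
exact: sum_unit_vec.
Qed.

Lemma derives_lincombN H (f r : V -> rat) :
  (forall v, 0 <= f v) ->
  (forall v, f v != 0 -> derives H (fun u => - unit_vec v u) (r v)) ->
  derives H (fun v => - f v) (\sum_v f v * r v).
Proof.
move=> f0 Hr.
have D v : derives H (fun u => f v * - unit_vec v u) (f v * r v).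
  have [fv|fv] := eqVneq (f v) 0; last exact: derivesZ (Hr v fv).
  by apply: derives_ext (derives0 H) _ _ => [u|]; rewrite fv mul0r.
apply: derives_ext (derives_sum (index_enum V) (fun v (_ : true) => D v)) _ _ => // v.
by rewrite -[f v](sum_unit_vec f) -sumrN; apply: eq_bigr => u _; rewrite mulrN.
Qed.

(** * Refutations of bounded size and branching on values of integer forms *)

Definition refutes H (s : nat) : Prop :=
  exists2 t : sp_tree V, sp_valid H t & (sp_size t <= s)%N.

(** Scaling by the inverse of [b] turns any positive constant into the 1 that a leaf demands. *)
Lemma refutes_leaf H a b s :
  derives H a b -> (forall v, a v = 0) -> 0 < b -> refutes H s.
Proof.
move=> D a0 b0.
have [|w [w1 w2 w3]] := derivesZ (c := b^-1) _ D.
  by rewrite invr_ge0 ltW.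
exists (SPLeaf w) => //=; rewrite /conic_contradiction w1 /= w3.
have -> : b^-1 * b = 1 by rewrite mulVf // gt_eqF.
rewrite eqxx andbT.
by apply/forallP => v; rewrite w2 a0 mulr0.
Qed.

Lemma refutes_weaken H s s' : refutes H s -> (s <= s')%N -> refutes H s'.
Proof. by case=> t tv ts ss'; exists t => //; apply: leq_trans ss'. Qed.

Lemma refutes_query H (a : {ffun V -> int}) (b : int) s1 s2 :
  refutes (query_le a b :: H) s1 -> refutes (query_ge a b :: H) s2 ->
  refutes H (s1 + s2).+1.
Proof.
case=> t1 v1 s1' [t2 v2 s2']; exists (SPNode a b t1 t2); rewrite /= ?v1 //.
by rewrite ltnS leq_add.
Qed.

Definition natform (L : V -> nat) : {ffun V -> int} := [ffun v => (L v)%:Z].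

Lemma derives_query_ge H L (b : int) :
  derives (query_ge (natform L) b :: H) (fun v => (L v)%:R) b%:~R.
Proof.
apply: derives_ext (derives_mem (mem_head _ _)) _ _ => // v /=.
by rewrite ffunE.
Qed.

Lemma derives_query_le H L (b : int) :
  derives (query_le (natform L) b :: H) (fun v => - (L v)%:R) (1 - b%:~R).
Proof.
apply: derives_ext (derives_mem (mem_head _ _)) _ _ => [v|] /=.
  by rewrite !ffunE rmorphN.
by rewrite rmorphB.
Qed.

Definition form_eq H (L : V -> nat) (k : nat) : Prop :=
  derives H (fun v => (L v)%:R) k%:R /\
  derives H (fun v => - (L v)%:R) (- k%:R).

Lemma form_eq_sub H H' L k : {subset H <= H'} -> form_eq H L k -> form_eq H' L k.
Proof. by move=> sH [? ?]; split; apply: derives_sub sH _. Qed.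

(** The queries L >= 1, ..., L >= K + 1 form a path. Leaving it at L >= k + 1 by the lower edge
    gives L <= k, and the previous query gave L >= k. The end of the path contradicts L <= K. *)
Lemma refutes_branch_value H (L : V -> nat) (K s : nat) :
  derives H (fun v => (L v)%:R) 0 ->
  derives H (fun v => - (L v)%:R) (- K%:R) ->
  (forall k H', {subset H <= H'} -> form_eq H' L k -> refutes H' s) ->
  refutes H (K.+1 * s.+1).
Proof.
move=> D0 DK Hk.
(* Here [j] counts the values k, ..., K that are still possible. *)
have chain j k H' : (k + j = K.+1)%N -> {subset H <= H'} ->
    derives H' (fun v => (L v)%:R) k%:R -> refutes H' (j * s.+1).
  elim: j k H' => [|j IH] k H' kj sH D.
    apply: refutes_leaf (derivesD D (derives_sub sH DK)) _ _.
      by move=> v; rewrite subrr.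
    by rewrite -[k]addn0 kj -natr1 addrAC subrr add0r.
  rewrite mulSn addSn.
  apply: (@refutes_query _ (natform L) k.+1%:Z).
    apply: (Hk k) => [l /sH|]; first by rewrite inE => ->; rewrite orbT.
    split; first exact: derives_cons.
    apply: derives_ext (derives_query_le _ _ _) _ _ => //.
    by rewrite -[_%:~R]/(k.+1%:R) -natr1 opprD addrCA subrr addr0.
  apply: (IH k.+1); first by rewrite addSnnS.
    by move=> l /sH lH; rewrite inE lH orbT.
  exact: derives_query_ge.
by apply: (chain K.+1 0%N).
Qed.

(** The form L1 + L2 - L equals N M for an integer form M, but its value k1 + k2 - k is t N + r with
    0 < r < N. So M would lie strictly between t and t + 1, and a single query on M excludes both
    sides. *)
Lemma refutes_incongruent H (L L1 L2 : V -> nat) (N k k1 k2 : nat) :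
  (0 < N)%N -> (forall v, L1 v + L2 v = L v %[mod N]) ->
  (forall v, L v <= L1 v + L2 v)%N ->
  form_eq H L k -> form_eq H L1 k1 -> form_eq H L2 k2 ->
  k1 + k2 != k %[mod N] -> refutes H 1.
Proof.
move=> N0 Lmod Lle [D D'] [D1 D1'] [D2 D2'] kN.
pose M v := ((L1 v + L2 v - L v) %/ N)%N.
have ME v : (L1 v)%:R + (L2 v)%:R = (L v)%:R + N%:R * (M v)%:R :> rat.
  rewrite -natrM -!natrD; congr _%:R; rewrite /M mulnC divnK ?subnKC //.
  by rewrite -eqn_mod_dvd // Lmod.
pose s : int := k1%:Z + k2%:Z - k%:Z.
have sN : (s %% N)%Z != 0.
  apply: contraNneq kN => s0.
  have : (k1%:Z + k2%:Z == k%:Z %[mod N])%Z.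
    by rewrite eqz_mod_dvd; apply/dvdz_mod0P.
  by rewrite -PoszD !modz_nat.
have := divz_eq s N; set r := (s %% N)%Z in sN *.
set t := (s %/ N)%Z => sE.
have r0 : 0 < r by rewrite lt_def sN modz_ge0 // -lt0n.
have rN : r < N by rewrite ltz_pmod.
have sR : k1%:R + k2%:R - k%:R = t%:~R * N%:R + r%:~R :> rat.
  move/(congr1 (fun z : int => z%:~R : rat)): sE.
  by rewrite /s !rmorphD rmorphN rmorphM.
have rR0 : 0 < r%:~R :> rat by rewrite ltr0z.
have rRN : r%:~R < N%:R :> rat by rewrite -[N%:R]/(N%:~R) ltr_int.
apply: (@refutes_query _ (natform M) (t + 1) 0 0).
  (* With M <= t the sum of the inequalities is 0 >= r; in the other branch, with M >= t + 1, it is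
     0 >= N - r. *)
  have := derives_query_le H M (t + 1).
  move/(derivesZ (ler0n _ N))/(derivesD (derives_cons _ D')).
  move/(derivesD (derives_cons _ D1))/(derivesD (derives_cons _ D2)).
  move=> X; apply: refutes_leaf X _ _ => [v|].
    by have := ME v; lra.
  by rewrite rmorphD /=; nra.
have := derives_query_ge H M (t + 1).
move/(derivesZ (ler0n _ N))/(derivesD (derives_cons _ D)).
move/(derivesD (derives_cons _ D1'))/(derivesD (derives_cons _ D2')).
move=> X; apply: refutes_leaf X _ _ => [v|].
  by have := ME v; lra.
by rewrite rmorphD /=; nra.
Qed.


(** * Consequences of the Boolean bounds and of the clauses *)

Section CnfHypotheses.
Variables (Phi : cnf V) (H : seq (lineq V)).
Hypothesis PhiH : {subset cnf_lineqs Phi <= H}.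

Lemma derives_lower u : derives H (unit_vec u) 0.
Proof.
have /PhiH/derives_mem D : lower_lineq u \in cnf_lineqs Phi.
  by rewrite !mem_cat map_f ?orbT // mem_enum.
by apply: derives_ext D _ _ => // v; rewrite /= ffunE /unit_vec; case: eqP.
Qed.

Lemma derives_upper u : derives H (fun v => - unit_vec u v) (- 1).
Proof.
have /PhiH/derives_mem D : upper_lineq u \in cnf_lineqs Phi.
  by rewrite !mem_cat [X in _ || (_ || X)]map_f ?orbT // mem_enum.
apply: derives_ext D _ _ => // v.
by rewrite /= ffunE rmorphN /unit_vec; case: eqP.
Qed.

Lemma derives_clause (C : clause V) :
  C \in Phi ->
  derives H (fun v => ((v, true) \in C)%:R - ((v, false) \in C)%:R)
            (1 - #|[set v | (v, false) \in C]|%:R).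
Proof.
move=> CPhi.
have /PhiH/derives_mem D : clause_lineq C \in cnf_lineqs Phi.
  by rewrite mem_cat map_f // mem_enum.
apply: derives_ext D _ _ => [v|]; rewrite /= ?ffunE rmorphB //=.
Qed.

(** Adding x_v <= 0 for the positive literals and x_v >= 1 for the negated ones to the inequality of
    [C] cancels every coefficient and leaves 0 >= 1. *)
Lemma refutes_falsified (C : clause V) s :
  C \in Phi ->
  (forall v, (v, true) \in C -> derives H (fun u => - unit_vec v u) 0) ->
  (forall v, (v, false) \in C -> derives H (unit_vec v) 1) ->
  refutes H s.
Proof.
move=> CPhi Ct Cf.
pose f e v : rat := ((v, e) \in C)%:R.
have f0 e v : 0 <= f e v by rewrite ler0n.
have fC e v : f e v != 0 -> (v, e) \in C by rewrite /f; case: (_ \in _).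
have Dt := derives_lincombN (f0 true) (fun v fv => Ct v (fC _ _ fv)).
have Df := derives_lincomb (f0 false) (fun v fv => Cf v (fC _ _ fv)).
apply: refutes_leaf (derivesD (derives_clause CPhi) (derivesD Dt Df)) _ _ => [v|].
  by rewrite /f; lra.
rewrite [X in _ + (X + _)]big1 => [|v _]; last by rewrite mulr0.
rewrite -sum1_card natr_sum big_mkcond /=.
under eq_bigr => v do rewrite inE.
rewrite add0r (eq_bigr (fun v => f false v * 1)) ?subrK // => v _.
by rewrite /f mulr1; case: (_ \in _).
Qed.

End CnfHypotheses.
End Derivations.

(** * Branching on field-valued variables in the direct encoding *)

Section Encoding.
Import Order.TTheory GRing.Theory Num.Theory.
Local Open Scope ring_scope.
Variables (F : finFieldType) (m n : nat) (A : 'M[F]_(m, n)) (b : 'cV[F]_m).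
Implicit Types (H : seq (lineq (bvar F n))) (z : 'I_n -> F).

Definition has_encoding H : Prop := {subset cnf_lineqs (cnf_encoding A b) <= H}.

Lemma at_least_one_in j : at_least_one F j \in cnf_encoding A b.
Proof. by rewrite !inE imset_f ?inE. Qed.

Lemma at_most_one_in (j : 'I_n) c c' :
  c != c' -> at_most_one j c c' \in cnf_encoding A b.
Proof.
move=> cc'; rewrite !inE; apply/orP; left; apply/orP; right.
by apply/imsetP; exists (j, (c, c')); rewrite ?inE.
Qed.

Lemma excl_clause_in i (z : 'cV[F]_n) :
  (A *m z) i 0 != b i 0 -> excl_clause A i z \in cnf_encoding A b.
Proof.
move=> bad; rewrite !inE; apply/orP; right.
by apply/imsetP; exists (i, z); rewrite ?inE.
Qed.

(** This is x_(j, c) >= 1 added to the at-most-one inequality - x_(j, c) - x_(j, c') >= -1. *)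
Lemma derives_other_values H j c c' :
  has_encoding H -> derives H (unit_vec (j, c)) 1 -> c' != c ->
  derives H (fun v => - unit_vec (j, c') v) 0.
Proof.
move=> okH D cc'; rewrite eq_sym in cc'.
have jcc' : (j, c) != (j, c') by rewrite xpair_eqE eqxx.
have D' := derives_clause okH (at_most_one_in j cc').
have cE e v :
    ((v, e) \in at_most_one j c c') = ~~ e && (v \in [set (j, c); (j, c')]).
  rewrite /at_most_one !in_set2 -!pair_eqE /pair_eq /= -!pair_eqE -andb_orl andbC.
  by case: e.
apply: derives_ext (derivesD D D') _ _ => [v|].
  rewrite !cE !inE /unit_vec /=.
  have [->|_] := eqVneq v (j, c); last by rewrite add0r sub0r.
  by rewrite (negPf jcc') /= sub0r subrr oppr0.
rewrite (_ : [set v | _] = [set (j, c); (j, c')]).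
  by rewrite cards2 jcc' addrA subrr.
by apply/setP => v; rewrite inE cE.
Qed.

Lemma refutes_branch_var H j s :
  has_encoding H ->
  (forall c H', {subset H <= H'} -> derives H' (unit_vec (j, c)) 1 ->
     refutes H' s) ->
  refutes H (#|F| * s.+1).
Proof.
move=> okH Hc.
have main (r : seq F) H' : {subset H <= H'} ->
    (forall c, c \notin r -> derives H' (fun v => - unit_vec (j, c) v) 0) ->
    refutes H' (size r * s.+1).
  elim: r H' => [|c r IH] H' sH D.
    have okH' : has_encoding H' by move=> l /okH/sH.
    apply: (refutes_falsified okH' _ (at_least_one_in j)) => v /imsetP[c _] //.
    by case=> ->; apply: D.
  have sub l : {subset H <= l :: H'}.
    by move=> x /sH xH; rewrite inE xH orbT.
  have xE v : unit_vec (j, c) v = (v == (j, c))%:R by [].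
  rewrite mulSn addSn addnC.
  apply: (@refutes_query _ _ (natform (fun v => nat_of_bool (v == (j, c)))) 1).
    apply: IH => // c' c'r; have [->|cc'] := eqVneq c' c.
      apply: derives_ext (derives_query_le _ _ _) _ _ => //.
    by apply/derives_cons/D; rewrite inE negb_or cc'.
  by apply: (Hc c) => //; apply: derives_ext (derives_query_ge _ _ _) _ _.
rewrite cardE; apply: main => // c; by rewrite mem_enum.
Qed.

(** With T(k) = 2 q^k - 2, one more variable costs q (T(k) + 1) = 2 q^(k+1) - q, which is at most
    T(k+1) because q >= 2. *)
Lemma refutes_brute_force H (s : seq 'I_n) :
  has_encoding H ->
  (forall z H', {subset H <= H'} ->
     (forall j, j \in s -> derives H' (unit_vec (j, z j)) 1) ->
     refutes H' 0) ->
  refutes H (2 * #|F| ^ size s - 2).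
Proof.
elim: s H => [|j s IH] H okH Hz.
  by apply: (Hz (fun=> 0)).
have q2 : (2 <= #|F|)%N by exact: card_finNzRing_gt1.
have X0 : (0 < #|F| ^ size s)%N by rewrite expn_gt0 ltnW.
apply: (@refutes_weaken _ _ (#|F| * (2 * #|F| ^ size s - 2).+1)); last first.
  rewrite /= expnS.
  by move: (_ ^ _)%N X0 (#|F|) q2 => X X0 q q2; nia.
apply: (@refutes_branch_var _ j) => // c H1 sH1 D.
apply: IH => [l /okH/sH1 //|z H' sH' Dz].
apply: (Hz (fun i => if i == j then c else z i)) => [l /sH1/sH' //|i].
rewrite inE; have [-> _|_] /= := eqVneq i j; last exact: Dz.
exact: derives_sub sH' D.
Qed.

(** * Residue forms and the refutation of a single equation *)

Variables (N : nat) (lam : F -> nat).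
Hypothesis lam_lt : forall x, (lam x < N)%N.
Hypothesis lamD : forall x x', lam (x + x') = ((lam x + lam x') %% N)%N.

Let N_gt0 : (0 < N)%N.
Proof. exact: leq_ltn_trans (lam_lt 0). Qed.

Lemma lam0 : lam 0 = 0.
Proof.
have := lamD 0 0; rewrite addr0 => /eqP.
rewrite -{1}(modn_small (lam_lt 0)) -{1}[lam 0]addn0 eqn_modDl mod0n.
by rewrite modn_small // => /eqP.
Qed.

Lemma lam_sum (I : Type) (r : seq I) (f : I -> F) :
  lam (\sum_(i <- r) f i) = ((\sum_(i <- r) lam (f i)) %% N)%N.
Proof.
elim: r => [|i r IH]; first by rewrite !big_nil lam0 mod0n.
by rewrite !big_cons lamD IH modnDmr.
Qed.

(** Once the variables of equation i are fixed, either the assignment violates the equation and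
    falsifies an exclusion clause, or the form has a value t congruent to lam (c b_i), hence
    different from k. *)
Lemma refutes_single_equation H i (c : F) (k : nat) :
  has_encoding H ->
  form_eq H (fun v : bvar F n => lam (c * A i v.1 * v.2)) k ->
  (k %% N)%N != lam (c * b i 0) ->
  refutes H (2 * #|F| ^ #|eq_support A i| - 2).
Proof.
move=> okH Dk kb; rewrite cardE; apply: refutes_brute_force => // z H' sH Dz.
have okH' : has_encoding H' by move=> l /okH/sH.
pose w : 'cV[F]_n := \col_j z j.
have [wb|wb] := eqVneq ((A *m w) i 0) (b i 0); last first.
  apply: (refutes_falsified okH' _ (excl_clause_in wb)) => v /imsetP[j jS] //.
  by case=> ->; rewrite mxE; apply: Dz; rewrite mem_enum.
pose t := (\sum_j lam (c * A i j * z j)%R)%N.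
have tb : (t %% N)%N = lam (c * b i 0).
  rewrite -wb mxE mulr_sumr lam_sum; congr (_ %% _)%N.
  by apply: eq_bigr => j _; rewrite mxE mulrA.
pose f (v : bvar F n) : rat := (lam (c * A i v.1 * v.2))%:R.
have f0 v : 0 <= f v by rewrite ler0n.
have fS v : f v != 0 -> v.1 \in enum (eq_support A i).
  rewrite mem_enum inE /f; apply: contraNneq => ->.
  by rewrite mulr0 mul0r lam0.
have fsum : \sum_v f v * (v.2 == z v.1)%:R = t%:R.
  rewrite natr_sum -(pair_bigA _ (fun j x => f (j, x) * (x == z j)%:R)) /=.
  apply: eq_bigr => j _; rewrite (bigD1 (z j)) //= eqxx mulr1.
  by rewrite big1 ?addr0 // => x /negPf ->; rewrite mulr0.
(* For j in the support, x_(j, z j) is 1. The other x_(j, x) are at least 0 by the Boolean bounds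
   and at most 0 by the at-most-one clauses. *)
have Dt : form_eq H' (fun v : bvar F n => lam (c * A i v.1 * v.2)) t.
  split.
    rewrite -fsum; apply: derives_lincomb => // -[j x] /fS /= jS.
    have [->|_] := eqVneq x (z j); first exact: Dz.
    exact: derives_lower okH' _.
  rewrite -fsum -sumrN.
  under eq_bigr do rewrite -mulrN.
  apply: derives_lincombN => // -[j x] /fS /= jS.
  have [->|xz] := eqVneq x (z j); first exact: derives_upper okH' _.
  by rewrite oppr0; apply: derives_other_values (Dz _ jS) _.
have {Dk}[Dk Dk'] := form_eq_sub sH Dk; case: Dt => Dt Dt'.
have : k != t by apply: contraNneq kb => ->; apply/eqP.
rewrite neq_ltn => /orP[] kt.
  apply: refutes_leaf (derivesD Dt Dk') _ _ => [v|]; first by rewrite subrr.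
  by rewrite subr_gt0 ltr_nat.
apply: refutes_leaf (derivesD Dk Dt') _ _ => [v|]; first by rewrite subrr.
by rewrite subr_gt0 ltr_nat.
Qed.

(** The Boolean bounds give the range that [refutes_branch_value] searches. *)
Lemma natform_bounds H (L : bvar F n -> nat) :
  has_encoding H ->
  derives H (fun v => (L v)%:R) 0 /\
  derives H (fun v => - (L v)%:R) (- (\sum_v L v)%:R).
Proof.
move=> okH; split.
  have -> : 0 = \sum_v (L v)%:R * 0 :> rat by rewrite big1 // => v; rewrite mulr0.
  by apply: derives_lincomb => // v _; apply: derives_lower okH _.
have -> : - (\sum_v L v)%:R = \sum_v (L v)%:R * (- 1) :> rat.
  by rewrite natr_sum -sumrN; apply: eq_bigr => v _; rewrite mulrN1.
by apply: derives_lincombN => // v _; apply: derives_upper okH _.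
Qed.

(** * Combinations of equations and the halving argument *)

Variable y : 'rV[F]_m.

Definition comb_coef (I : seq 'I_m) (j : 'I_n) : F := \sum_(i <- I) y 0 i * A i j.
Definition comb_rhs (I : seq 'I_m) : F := \sum_(i <- I) y 0 i * b i 0.
Definition comb_form (I : seq 'I_m) (v : bvar F n) : nat :=
  lam (comb_coef I v.1 * v.2).

Lemma comb_form_nil v : comb_form [::] v = 0.
Proof. by rewrite /comb_form /comb_coef big_nil mul0r lam0. Qed.

Lemma comb_form_cat I1 I2 v :
  comb_form (I1 ++ I2) v = ((comb_form I1 v + comb_form I2 v) %% N)%N.
Proof. by rewrite /comb_form /comb_coef big_cat mulrDl lamD. Qed.

Variable d : nat.
Hypothesis Ad : width_le A d.

(** A coefficient at (j, c) can be nonzero only if z_j occurs in an equation of [I]. There are at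
    most |I| d such occurrences, each with q values of c and residues below N; the bound is thus
    independent of n. *)
Lemma sum_comb_form I : (\sum_v comb_form I v <= size I * (d * (#|F| * N)))%N.
Proof.
have le v : (comb_form I v <= \sum_(i <- I) (A i v.1 != 0%R) * N)%N.
  elim: I => [|i I IH]; first by rewrite comb_form_nil.
  rewrite big_cons; have [Ai|Ai] := eqVneq (A i v.1) 0.
    by rewrite /comb_form /comb_coef big_cons Ai mulr0 add0r.
  by rewrite mul1n (leq_trans (ltnW (lam_lt _))) ?leq_addr.
apply: leq_trans (leq_sum _ (fun v _ => le v)) _.
rewrite exchange_big /=; elim: I {le} => [|i I IH]; first by rewrite big_nil.
rewrite big_cons mulSn leq_add //.
rewrite -(pair_bigA _ (fun j (x : F) => ((A i j != 0%R) * N)%N)) /=.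
under eq_bigr do rewrite sum_nat_const mulnCA.
rewrite -big_distrl /= leq_mul2r; apply/orP; right.
apply: leq_trans (Ad i); rewrite -sum1dep_card [leqRHS]big_mkcond /=.
by apply: leq_sum => j _; case: ifP.
Qed.

(** A form on at most m equations has at most B - 1 candidate values; the spare 1 absorbs the
    queries themselves. *)
Let B := (m * (d * (#|F| * N))).+2.

(** Induction on the number [h] of halvings. One halving finds the values of two forms and so
    multiplies the size by at most B^2; the factor 2 q^d pays for the final exhaustive search. *)
Lemma refutes_combination h I H k :
  has_encoding H -> (size I <= 2 ^ h)%N -> (size I <= m)%N ->
  form_eq H (comb_form I) k -> (k %% N)%N != lam (comb_rhs I) ->
  refutes H (2 * #|F| ^ d * B ^ (2 * h)).-1.
Proof.
have q0 : (0 < #|F|)%N by apply/card_gt0P; exists 0.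
elim: h I H k => [|h IH] I H k okH Ih Im Dk kI.
  (* A half may be empty. Its form is 0, while the incongruence makes [k] positive, so 0 >= k is
     already a contradiction. *)
  rewrite muln1; case: I Ih Im Dk kI => [|i [|//]] _ _ Dk kI.
    case: Dk => Dk _; apply: refutes_leaf Dk _ _ => [v|].
      by rewrite comb_form_nil.
    rewrite ltr0n lt0n; apply: contraNneq kI => ->.
    by rewrite /comb_rhs big_nil lam0 mod0n.
  apply: (@refutes_weaken _ _ (2 * #|F| ^ #|eq_support A i| - 2)).
    apply: (refutes_single_equation okH (c := y 0 i) (k := k)).
      case: Dk => Dk Dk'; split.
        by apply: derives_ext Dk _ _ => // v; rewrite /comb_form /comb_coef big_seq1.
      by apply: derives_ext Dk' _ _ => // v; rewrite /comb_form /comb_coef big_seq1.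
    by move: kI; rewrite /comb_rhs big_seq1.
  rewrite -subn1 leq_sub // leq_mul2l leq_pexp2l //; exact: Ad.
pose I1 := take (2 ^ h) I; pose I2 := drop (2 ^ h) I.
have II : I = I1 ++ I2 by rewrite cat_take_drop.
have sI : (size I1 + size I2 <= m)%N by rewrite -size_cat -II.
have I1h : (size I1 <= 2 ^ h)%N by rewrite size_take; case: ltnP.
have I2h : (size I2 <= 2 ^ h)%N.
  by rewrite size_drop leq_subLR addnn -mul2n -expnS.
have sumB J : (size J <= m)%N -> (\sum_v comb_form J v < B.-1)%N.
  by move=> Jm; rewrite ltnS (leq_trans (sum_comb_form _)) // leq_mul2r Jm orbT.
have I1m : (size I1 <= m)%N by apply: leq_trans sI; rewrite leq_addr.
have I2m : (size I2 <= m)%N by apply: leq_trans sI; rewrite leq_addl.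
set T := (2 * #|F| ^ d * B ^ (2 * h))%N.
have T0 : (0 < T)%N by rewrite !muln_gt0 !expn_gt0 q0.
apply: (@refutes_weaken _ _ ((\sum_v comb_form I1 v).+1
          * ((\sum_v comb_form I2 v).+1 * T).+1)); last first.
  have -> : (2 * #|F| ^ d * B ^ (2 * h.+1) = T * (B * B))%N.
    by rewrite mulnS addnC expnD mulnA.
  move: (sumB _ I1m) (sumB _ I2m); rewrite /B /=.
  move: (_ * (d * _))%N (\sum_v comb_form I1 v)%N (\sum_v comb_form I2 v)%N T0.
  move: T => T X s1 s2 T0 s1X s2X.
  rewrite -ltnS prednK ?muln_gt0 ?T0 //.
  apply: (@leq_ltn_trans (X.+1 * (X.+1 * T).+1)%N); last by nia.
  by rewrite leq_mul // ltnS leq_mul.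
have [D0 DK] := natform_bounds (comb_form I1) okH.
apply: refutes_branch_value D0 DK _ => k1 H1 sH1 Dk1.
have okH1 : has_encoding H1 by move=> l /okH/sH1.
have [D0 DK] := natform_bounds (comb_form I2) okH1.
(* A subtree of size T - 1 together with the query above it costs exactly T; this is the purpose of
   [.-1] in the bound. *)
rewrite -[T in (_ * T)%N](prednK T0).
apply: refutes_branch_value D0 DK _ => k2 H2 sH2 Dk2.
have okH2 : has_encoding H2 by move=> l /okH1/sH2.
have {}Dk1 := form_eq_sub sH2 Dk1.
have {}Dk := form_eq_sub (fun l lH => sH2 l (sH1 l lH)) Dk.
have [k1I|k1I] := eqVneq (k1 %% N)%N (lam (comb_rhs I1)); last exact: IH Dk1 k1I.
have [k2I|k2I] := eqVneq (k2 %% N)%N (lam (comb_rhs I2)); last exact: IH Dk2 k2I.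
have kk : (k1 + k2 != k %[mod N])%N.
  apply: contraNneq kI => <-; rewrite -modnDm k1I k2I.
  by rewrite II /comb_rhs big_cat lamD.
have T1 : (1 <= T.-1)%N.
  rewrite -subn1 leq_subRL // /T -mulnA.
  by rewrite (@leq_mul 2 1) // muln_gt0 !expn_gt0 q0.
apply: refutes_weaken T1.
apply: (refutes_incongruent N_gt0 _ _ Dk Dk1 Dk2 kk) => v.
  by rewrite [in RHS]II comb_form_cat modn_mod.
by rewrite II comb_form_cat leq_mod.
Qed.

End Encoding.

(** [F] is a vector space over its prime field, and some coordinate of the nonzero vector [e] is
    nonzero. That coordinate map is [lam], and [N] is the characteristic. *)
Lemma additive_residue (F : finFieldType) (e : F) :
  e != 0%R -> exists (N : nat) (lam : F -> nat),
    [/\ (N <= #|F|)%N, forall x, (lam x < N)%N,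
        forall x x', lam (x + x')%R = ((lam x + lam x') %% N)%N & lam e != 0].
Proof.
move=> e0; have [p p_pr pF] := finPcharP F.
pose L := pPrimeCharType pF.
pose X := vbasis (fullv : {vspace L}).
have : [exists i, coord X i (e : L) != 0%R].
  apply: contraNT e0; rewrite negb_exists => /forallP e0.
  rewrite [e](@coord_vbasis _ L e fullv) ?memvf //.
  apply/eqP/big1 => i _; move: (e0 i); rewrite negbK => /eqP->.
  by rewrite GRing.scale0r.
case/existsP=> i ei; exists p, (fun x : L => nat_of_ord (coord X i x)); split.
- have leX r : 1 < p ^ r -> p <= p ^ r.
    case: r => [|r] // _; first by rewrite expnS leq_pmulr // expn_gt0 prime_gt0.
  by rewrite (card_pprimeChar pF) leX // -(card_pprimeChar pF) card_finNzRing_gt1.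
- by move=> x; apply: leq_trans (ltn_ord _) _; rewrite Fp_cast.
- move=> x x'; rewrite (GRing.raddfD (coord X i)) /=.
  by congr (_ %% _)%N; apply: Fp_cast.
- exact: ei.
Qed.

(** * Refuting a whole unsatisfiable system *)

Section UnsatisfiableSystems.
Import Order.TTheory GRing.Theory Num.Theory.
Local Open Scope ring_scope.
Variables (F : finFieldType) (m n : nat) (A : 'M[F]_(m, n)) (b : 'cV[F]_m).
Hypothesis unsat : ~ satisfiable A b.

(** Since b is outside the column space of A, some column of the cokernel of A^T does not annihilate
    b. The transposes are there because matrix spaces are row spaces. *)
Lemma unsat_certificate :
  exists y : 'rV[F]_m, y *m A = 0 /\ (y *m b) 0 0 != 0.
Proof.
have : ~~ (b^T <= A^T)%MS.
  apply/negP => /submxP[z bz]; apply: unsat; exists z^T.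
  by apply: trmx_inj; rewrite trmx_mul trmxK.
rewrite submxE => /rV0Pn[k bk]; exists (col k (cokermx A^T))^T.
split.
  by apply: trmx_inj; rewrite trmx_mul trmxK colE mulmxA mulmx_coker mul0mx trmx0.
have -> : (col k (cokermx A^T))^T *m b = (col k (b^T *m cokermx A^T))^T.
  by rewrite !colE -!mulmxA !trmx_mul trmxK.
by rewrite mxE mxE.
Qed.

(** The exclusion clause of an equation 0 = b_i is empty, and its inequality is 0 >= 1. *)
Lemma refutes_zero_row i :
  (forall j, A i j = 0) -> b i 0 != 0 ->
  refutes (cnf_lineqs (cnf_encoding A b)) 0.
Proof.
move=> Ai bi.
have Az : (A *m (0 : 'cV[F]_n)) i 0 != b i 0 by rewrite mulmx0 mxE eq_sym.
by apply: (refutes_falsified (fun _ => id) _ (excl_clause_in Az)) => v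
  /imsetP[j]; rewrite inE Ai eqxx.
Qed.

(** For m <= 1 the exponent [C * trunc_log 2 m] is 0, which leaves no room for a search. The
    certificate has a nonzero y_i, so y A = 0 forces row i to vanish. *)
Lemma refutes_one_equation :
  (m <= 1)%N -> refutes (cnf_lineqs (cnf_encoding A b)) 0.
Proof.
move=> m1; have [y [yA yb]] := unsat_certificate.
have m1E (i i' : 'I_m) : i = i'.
  by apply: val_inj => /=; move: (ltn_ord i) (ltn_ord i'); lia.
have sumE i (f : 'I_m -> F) : \sum_i' f i' = f i.
  by rewrite (bigD1 i) //= big1 ?addr0 // => i'; rewrite (m1E i' i) eqxx.
have [i _] : exists i : 'I_m, true.
  case: (pickP (fun _ : 'I_m => true)) => [i _|m0]; first by exists i.
  by case/eqP: yb; rewrite mxE big_pred0.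
move: yb; rewrite mxE (sumE i) mulf_eq0 negb_or => /andP[yi bi].
apply: (refutes_zero_row (i := i)) bi => j.
have /rowP/(_ j)/eqP := yA.
by rewrite !mxE (sumE i) mulf_eq0 (negPf yi) => /eqP.
Qed.

(* For d = 1 the bound (m * q ^ d.-1) ^ O(log m) does not depend on q, so trying all q
   values of a variable is too expensive. *)
Lemma refutes_width_one :
  width_le A 1 -> refutes (cnf_lineqs (cnf_encoding A b)) 0.
Proof.
move=> A1; set H := cnf_lineqs _.
have okH : {subset H <= H} by [].
have [/existsP[i /andP[/eqP Ai bi]]|] :=
    boolP [exists i, (eq_support A i == set0) && (b i 0 != 0)].
  apply: (refutes_zero_row (i := i)) bi => j.
  by apply/eqP; have := in_set0 j; rewrite -Ai inE => /negbFE.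
rewrite negb_exists => /forallP row0.
(* Every equation now concerns at most one variable. If each variable had a value satisfying all its
   equations, these values would solve the system. *)
have [/forallP good|] := boolP [forall j, exists c, forall i,
    (j \in eq_support A i) ==> (A i j * c == b i 0)].
  case: unsat; exists (\col_j xchoose (existsP (good j))).
  apply/colP => i; rewrite mxE; under eq_bigr do rewrite mxE.
  have [Ai|[j jA]] := set_0Vmem (eq_support A i).
    have := row0 i; rewrite Ai eqxx negbK => /eqP->; apply: big1 => j _.
    by have := in_set0 j; rewrite -Ai inE => /negbFE/eqP->; rewrite mul0r.
  rewrite (bigD1 j) //= big1 => [|j' jj'].
    rewrite addr0; apply/eqP.
    by move/forallP/(_ i)/implyP: (xchooseP (existsP (good j))); apply.
  apply/eqP; rewrite mulf_eq0; apply/orP; left.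
  apply: contraNT jj' => Aj'; apply/eqP.
  by apply: (card_le1_eqP (A1 i)) => //; rewrite inE.
rewrite negb_forall => /existsP[j]; rewrite negb_exists => /forallP bad.
apply: (refutes_falsified okH _ (at_least_one_in A b j)) => v /imsetP[c _] //.
case=> -> {v}.
(* An equation violated by z_j = c has a one-literal exclusion clause, which yields x_(j, c) <= 0
   without a query. *)
have := bad c; rewrite negb_forall => /existsP[i].
rewrite negb_imply => /andP[jA Ac].
have AE : eq_support A i = [set j].
  by apply/eqP; rewrite eq_sym eqEcard sub1set jA cards1 A1.
pose z : 'cV[F]_n := const_mx c.
have Az : (A *m z) i 0 != b i 0.
  rewrite mxE (bigD1 j) //= big1 ?addr0 ?mxE // => j' jj'.
  have : j' \notin eq_support A i by rewrite AE inE.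
  by rewrite inE negbK => /eqP->; rewrite mul0r.
have cE : excl_clause A i z = [set ((j, c), false)].
  by rewrite /excl_clause AE imset_set1 mxE.
have vE e v : ((v, e) \in excl_clause A i z) = ~~ e && (v == (j, c)).
  by rewrite cE in_set1 -pair_eqE /pair_eq /= andbC; case: e.
apply: derives_ext (derives_clause okH (excl_clause_in Az)) _ _ => [v|].
  by rewrite !vE /= sub0r.
rewrite (_ : [set v | _] = [set (j, c)]) ?cards1 ?subrr //.
by apply/setP => v; rewrite inE vE in_set1.
Qed.

(** The halving starts from all equations: y A = 0 makes the form identically 0, while lam (y b) is
    nonzero. As m < 2^h for h = [(trunc_log 2 m).+1], that many halvings suffice, and N <= q removes
    N from the bound. *)
Lemma refutes_system d :
  width_le A d ->
  refutes (cnf_lineqs (cnf_encoding A b))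
    (2 * #|F| ^ d * (m * (d * (#|F| * #|F|))).+2 ^ (2 * (trunc_log 2 m).+1)).-1.
Proof.
move=> Ad; have [y [yA yb]] := unsat_certificate.
have [N [lam [NF lam_lt lamD lam_e]]] := additive_residue yb.
have l0 := lam0 lam_lt lamD.
have R : refutes (cnf_lineqs (cnf_encoding A b)) 
    (2 * #|F| ^ d * (m * (d * (#|F| * N))).+2 ^ (2 * (trunc_log 2 m).+1)).-1.
  apply: (refutes_combination (b := b) lam_lt lamD (y := y) Ad
    (I := enum 'I_m) (k := 0)) => //.
  - by rewrite size_enum_ord ltnW // trunc_log_ltn.
  - by rewrite size_enum_ord.
  - have L0 v : comb_form A lam y (enum 'I_m) v = 0.
      rewrite /comb_form /comb_coef big_enum.
      have /rowP/(_ v.1) := yA; rewrite !mxE => ->.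
      by rewrite mul0r l0.
    by split; apply: derives_ext (derives0 _) _ _ => [v|]; rewrite ?L0 ?oppr0.
  by rewrite mod0n eq_sym /comb_rhs big_enum; rewrite mxE in lam_e.
apply: refutes_weaken R _.
rewrite -!subn1 leq_sub2r // leq_mul2l leq_exp2r // !ltnS.
by rewrite !leq_mul2l NF !orbT.
Qed.

End UnsatisfiableSystems.

(** * Arithmetic of the two size bounds *)

Lemma size_bound_mqd m q d t s :
  1 < m -> 1 < q -> 0 < d -> 0 < t ->
  s < 2 * q ^ d * (m * (d * (q * q))).+2 ^ (2 * t.+1) ->
  s <= (m * q * d) ^ (9 * t) * q ^ d.
Proof.
move=> m1 q1 d0 t0 /ltnW sle; apply: leq_trans sle _.
set X := m * q * d.
have X4 : 4 <= X by rewrite /X -[4]/(2 * 2 * 1) !leq_mul.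
have BX : (m * (d * (q * q))).+2 <= X ^ 2.
  by rewrite /X; have : 2 <= m * d; nia.
rewrite mulnAC [leqRHS]mulnC mulnC leq_mul2l; apply/orP; right.
(* The factor 2 is at most X^t, and the power of the base is at most X^(4 (t + 1)), hence at most
   X^(8 t) since t >= 1. *)
apply: (@leq_trans (X ^ t * X ^ (8 * t))); last first.
  by rewrite -expnD -[t in t + _]mul1n -mulnDl.
rewrite leq_mul //.
  by apply: (@leq_trans (X ^ 1)); rewrite ?leq_pexp2l // (leq_trans _ X4).
apply: (@leq_trans ((X ^ 2) ^ (2 * t.+1))); first by rewrite leq_exp2r.
rewrite -expnM leq_pexp2l ?(leq_trans _ X4) //; lia.
Qed.

(** For d >= 2 both q and d are at most q^(d-1), and d <= 2 (d - 1). Hence m q d and q^d are each at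
    most Y^2, and the exponents add up to 18 t + 2 t. *)
Lemma size_bound_cnf m q d t :
  0 < m -> 1 < q -> 1 < d -> 0 < t ->
  (m * q * d) ^ (9 * t) * q ^ d <= (m * q ^ d.-1) ^ (20 * t).
Proof.
move=> m0 q1 d1 t0; set Y := m * q ^ d.-1.
have q0 : 0 < q by apply: ltnW.
have Y0 : 0 < Y by rewrite muln_gt0 m0 expn_gt0 q0.
have qY : q ^ d <= Y ^ 2.
  apply: (@leq_trans ((q ^ d.-1) ^ 2)); last by rewrite leq_exp2r // leq_pmull.
  by rewrite -expnM leq_pexp2l //; lia.
have XY : m * q * d <= Y ^ 2.
  rewrite /Y expnMn -mulnA leq_mul //; first by rewrite -[m]expn1 -expnM leq_pexp2l.
  rewrite expnS expn1 leq_mul //.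
    by rewrite -{1}[q]expn1 leq_pexp2l //; lia.
  apply: (@leq_trans (2 ^ d.-1)); last by case: d.-1 => // r; rewrite leq_exp2r.
  by rewrite -ltnS -[d in d < _](prednK (ltnW d1)) ltnS ltn_expl.
apply: (@leq_trans ((Y ^ 2) ^ (9 * t) * (Y ^ 2) ^ t)).
  rewrite leq_mul ?leq_exp2r ?muln_gt0 //.
  by apply: leq_trans qY _; rewrite -{1}[Y ^ 2]expn1 leq_pexp2l // expn_gt0 Y0.
by rewrite -!expnM -expnD leq_pexp2l //; lia.
Qed.

Theorem theorem4p1 :
  exists C : nat,
  forall (F : finFieldType) (m n d : nat)
         (A : 'M[F]_(m, n)) (b : 'cV[F]_m),
    width_le A d ->
    ~ satisfiable A b ->
    exists t : sp_tree (bvar F n),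
      [/\ sp_refutation (cnf_encoding A b) t,
          sp_size t <= (m * #|F| * d) ^ (C * trunc_log 2 m) * #|F| ^ d
        & sp_size t <= (m * #|F| ^ d.-1) ^ (C * trunc_log 2 m)].
Proof.
exists 20 => F m n d A b Ad unsat.
(* A tree without queries meets both bounds whatever they are; this settles m <= 1 and d <= 1, which
   the arithmetic estimates do not cover. *)
have small : refutes (cnf_lineqs (cnf_encoding A b)) 0 -> exists t : sp_tree (bvar F n),
      [/\ sp_refutation (cnf_encoding A b) t,
          sp_size t <= (m * #|F| * d) ^ (20 * trunc_log 2 m) * #|F| ^ d
        & sp_size t <= (m * #|F| ^ d.-1) ^ (20 * trunc_log 2 m)].
  by case=> t Ht; rewrite leqn0 => /eqP t0; exists t; rewrite t0.
have [m1|m1] := leqP m 1; first exact/small/refutes_one_equation.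
have [d1|d1] := leqP d 1.
  by apply/small/refutes_width_one => // i; apply: leq_trans (Ad i) d1.
have q1 := card_finNzRing_gt1 F.
have t0 : 0 < trunc_log 2 m by rewrite trunc_log_gt0.
have [t Ht st] := refutes_system unsat Ad.
have {}st : sp_size t <= (m * #|F| * d) ^ (9 * trunc_log 2 m) * #|F| ^ d.
  apply: size_bound_mqd; rewrite ?(ltnW d1) //.
  rewrite -[ltnRHS]prednK //; first by rewrite !muln_gt0 !expn_gt0 (ltnW q1).
exists t; split => //.
  apply: leq_trans st _; rewrite leq_mul2r; apply/orP; right.
  by rewrite leq_pexp2l ?leq_mul2r ?orbT // !muln_gt0 (ltnW m1) (ltnW q1) (ltnW d1).
by apply: leq_trans st _; apply: size_bound_cnf; rewrite // ltnW.
Qed.
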